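(* Let $v$ be a positive integer. If $\gcd(v,6)=1$ and $v \notin \{5,7,11\}$, then there exists an $\mathrm{MCPQLS}(v)$.
   Context: $\mathcal{H}_n=\mathbb{C}^n$ denotes the $n$-dimensional complex Hilbert space. A quantum Latin square of order $n$, $\mathrm{QLS}(n)$, is an $n\times n$ array whose entries are unit column vectors of $\mathcal{H}_n$ such that the entries of each row and of each column form an orthonormal basis of $\mathcal{H}_n$. Two unit vectors $u,v$ are regarded as identical if $u=e^{i\theta}v$ for some real $\theta$, and as distinct otherwise. A transversal of a $\mathrm{QLS}(n)$ is a set of $n$ cells, no two in the same row or column, whose entries form an orthonormal basis of $\mathcal{H}_n$. A pandiagonal quantum Latin square $\mathrm{PQLS}(n)$ is a $\mathrm{QLS}(n)$, with rows and columns indexed by $\mathbb{Z}_n$, in which the main diagonal, the anti-diagonal and all broken diagonals in both directions (i.e. all cell sets $\{(i,j): i-j\equiv s \pmod n\}$ and $\{(i,j): i+j\equiv s\pmod n\}$, $s\in\mathbb{Z}_n$) are transversals. An $\mathrm{MCPQLS}(n)$ is a $\mathrm{PQLS}(n)$ of maximum cardinality, i.e. whose $n^2$ entries are pairwise distinct (up to global phase). *)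

(* Defs.v *)
From mathcomp Require Import all_boot all_order all_algebra.
From mathcomp Require Import all_classical all_reals.
From mathcomp Require Import trigo.
From mathcomp.real_closed Require Export complex.

Set Implicit Arguments.
Unset Strict Implicit.
Unset Printing Implicit Defensive.

Import Order.TTheory GRing.Theory Num.Theory.

Local Open Scope ring_scope.
Local Open Scope complex_scope.

(* The standard Hermitian inner product of column vectors, \sum_k u_k * v_k^*;
   the library's [dotmx] is stated for row vectors. *)
Definition inner (R : realType) (n : nat) (u v : 'cV[R[i]]_n) : R[i] :=
  dotmx u^T v^T.

Definition unit_vector (R : realType) (n : nat) (u : 'cV[R[i]]_n) : Prop :=
  inner u u = 1.

(* The family (f x), x in A, is an orthonormal basis; repetitions in the
   family are not allowed. *)
Definition orthonormal_basis_on (R : realType) (n : nat) (I : finType)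
    (A : {set I}) (f : I -> 'cV[R[i]]_n) : Prop :=
  {in A &, forall x y, inner (f x) (f y) = (x == y)%:R} /\
  basis_of fullv [seq f x | x in A].

(* u = e^{i theta} v *)
Definition phase_equiv (R : realType) (n : nat) (u v : 'cV[R[i]]_n) : Prop :=
  exists theta : R, u = (cos theta +i* sin theta) *: v.

Record is_QLS (R : realType) (n : nat) (L : 'I_n -> 'I_n -> 'cV[R[i]]_n) :
    Prop := IsQLS {
  qls_unit : forall i j, unit_vector (L i j);
  qls_row : forall i, orthonormal_basis_on [set: 'I_n] (fun j => L i j);
  qls_col : forall j, orthonormal_basis_on [set: 'I_n] (fun i => L i j)
}.

Record is_QLS_transversal (R : realType) (n : nat)
    (L : 'I_n -> 'I_n -> 'cV[R[i]]_n) (T : {set 'I_n * 'I_n}) : Prop :=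
  IsQLSTransversal {
  transversal_card : #|T| = n;
  transversal_row : {in T &, forall c d, c.1 = d.1 -> c = d};
  transversal_col : {in T &, forall c d, c.2 = d.2 -> c = d};
  transversal_basis : orthonormal_basis_on T (fun c => L c.1 c.2)
}.

(* Rows and columns are indexed by the residues 0, ..., n-1. The main diagonal
   is [left_diagonal] for s = 0; the anti-diagonal is [right_diagonal] for
   s = n - 1. *)
Definition left_diagonal (n : nat) (s : 'I_n) : {set 'I_n * 'I_n} :=
  [set c : 'I_n * 'I_n | (c.1%:Z - c.2%:Z == s%:Z %[mod n%:Z])%Z].

Definition right_diagonal (n : nat) (s : 'I_n) : {set 'I_n * 'I_n} :=
  [set c : 'I_n * 'I_n | (c.1%:Z + c.2%:Z == s%:Z %[mod n%:Z])%Z].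

Definition is_PQLS (R : realType) (n : nat)
    (L : 'I_n -> 'I_n -> 'cV[R[i]]_n) : Prop :=
  [/\ is_QLS L,
      forall s : 'I_n, is_QLS_transversal L (left_diagonal s)
    & forall s : 'I_n, is_QLS_transversal L (right_diagonal s)].

Definition is_MCPQLS (R : realType) (n : nat)
    (L : 'I_n -> 'I_n -> 'cV[R[i]]_n) : Prop :=
  is_PQLS L /\
  forall i j k l : 'I_n, (i, j) <> (k, l) -> ~ phase_equiv (L i j) (L k l).

(* Main.v *)
Require Import Defs.
From mathcomp Require Import all_boot all_order all_algebra.
From mathcomp Require Import all_classical all_reals.
From mathcomp Require Import cyclic separable cyclotomic finfield spectral zify ring.

(* Let w be a primitive v-th root of unity and f a map on Z/v such that f,
   x |-> f x + x and x |-> f x - x are bijective (a toroidal queens solution).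
   The vectors L(i,j)_k = v^(-1/2) w^(j k + i f(k)) form a PQLS: on a row, a
   column or a broken diagonal, the inner product of two distinct entries is,
   up to normalisation, a sum of w^(d g(k)) with d <> 0 and g one of id, f,
   f + id, f - id, hence the sum of all powers of some w^d <> 1.
   Two entries agree up to phase iff a k + b f(k) is constant mod v, where
   (b,a) is the difference of their positions, so the entries are distinct as
   soon as the graph of f lies in no coset of a proper subgroup of (Z/v)^2.
   For a prime p >= 13, such an f is x |-> a x on squares and x |-> b x
   elsewhere, where a <> b and the pairs (a,b), (a+1,b+1), (a-1,b-1) have equal
   quadratic characters: there are p - 3 > 8 candidates for 8 patterns. For 25,
   35, 49, 55, 77 and 121, f is given explicitly. Finally, a solution f mod m
   lifts to x |-> f(x mod m) + m c (x div m) mod m q for any prime q >= 5 and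
   c = 2 or c = -2. *)

Set Implicit Arguments.
Unset Strict Implicit.
Unset Printing Implicit Defensive.

Import Order.TTheory GRing.Theory Num.Theory.

Local Open Scope ring_scope.

(** * The quadratic character and two-slope permutations of a finite field *)

Section QuadraticCharacter.

Variable F : finFieldType.
Hypothesis F_odd : odd #|F|.

Definition quad_char (x : F) : F := x ^+ #|F|.-1./2.

Lemma quad_charM : {morph quad_char : x y / x * y}.
Proof. by move=> x y; rewrite /quad_char exprMn. Qed.

Lemma quad_char_sqr (x : F) : x != 0 -> quad_char x ^+ 2 = 1.
Proof.
move=> x_neq0; have F_gt0 : (0 < #|F|)%N by apply/card_gt0P; exists 0.
have E : (#|F|.-1./2 * 2 = #|F|.-1)%N by lia.
rewrite /quad_char -exprM E; apply: (mulfI x_neq0).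
by rewrite -exprS prednK // expf_card mulr1.
Qed.

(** Nonzero elements have character 1 or -1, so the Boolean test against 1 determines the whole
    character. The test form is what the pigeonhole argument compares. *)
Lemma quad_char_eqM (x y z : F) : x != 0 -> y != 0 ->
  (quad_char x == 1) = (quad_char y == 1) ->
  quad_char (x * z) = quad_char (y * z).
Proof.
move=> /quad_char_sqr/eqP x2 /quad_char_sqr/eqP y2; rewrite !quad_charM.
move: x2 y2; rewrite !sqrf_eq1.
have [-> _|_ /= /eqP-> ] := eqVneq (quad_char x) 1.
  by move=> _ /esym/eqP->.
by case/orP=> /eqP-> // /esym; rewrite eqxx.
Qed.

(** Otherwise all [#|F|.-1] nonzero elements would be roots of X^h - 1 with h half that number. *)
Lemma quad_char_nonresidue : (1 < #|F|.-1)%N ->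
  exists2 y : F, y != 0 & quad_char y != 1.
Proof.
move=> F_gt2; have h_gt0 : (0 < #|F|.-1./2)%N by lia.
have [/existsP[y /andP[]]|noy] := boolP [exists y : F, (y != 0) && (quad_char y != 1)].
  by exists y.
have /(max_unity_roots h_gt0) : all (#|F|.-1./2).-unity_root (enum (predC1 (0 : F))).
  apply/allP=> y; rewrite mem_enum inE => y_neq0; rewrite unity_rootE.
  by move/existsPn/(_ y): noy; rewrite y_neq0 negbK.
rewrite enum_uniq -cardE cardC1 => /(_ isT) h; move: h F_gt2; set h := #|F|.-1; lia.
Qed.

Definition residue_scaling (a b x : F) : F :=
  (if quad_char x == 1 then a else b) * x.

(** Both slopes have the same character, so equal images come from arguments of equal character.
    These arguments are scaled by the same nonzero slope. *)
Lemma residue_scaling_inj (a b : F) : a != 0 -> b != 0 ->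
  (quad_char a == 1) = (quad_char b == 1) -> injective (residue_scaling a b).
Proof.
move=> a_neq0 b_neq0 ab x y; rewrite /residue_scaling.
have abx z := quad_char_eqM z a_neq0 b_neq0 ab.
have chib_neq0 : quad_char b != 0 by rewrite /quad_char expf_neq0.
case: (eqVneq (quad_char x) 1) => x1; case: (eqVneq (quad_char y) 1) => y1 E.
- exact: (mulfI a_neq0).
- move: (congr1 quad_char E); rewrite abx !quad_charM => /(mulfI chib_neq0) xy.
  by rewrite -xy x1 eqxx in y1.
- move: (congr1 quad_char E); rewrite abx !quad_charM => /(mulfI chib_neq0) xy.
  by rewrite xy y1 eqxx in x1.
- exact: (mulfI b_neq0).
Qed.

Lemma exists_residue_scaling : (11 < #|F|)%N ->
  exists ab : F * F, [/\ ab.1 != ab.2,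
    injective (residue_scaling ab.1 ab.2),
    injective (fun x => residue_scaling ab.1 ab.2 x + x) &
    injective (fun x => residue_scaling ab.1 ab.2 x - x)].
Proof.
(* Removing 0, 1 and -1 keeps a, a - 1 and a + 1 nonzero, as [residue_scaling_inj] requires of each
   pair of slopes. *)
move=> F_gt11; pose A := [set~ 0] :\ 1 :\ -1 : {set F}.
pose pat (a : F) :=
  (quad_char a == 1, quad_char (a + 1) == 1, quad_char (a - 1) == 1).
have cardA : (8 < #|A|)%N.
  have := cardsD1 (-1) ([set~ 0] :\ (1 : F)); have := cardsD1 (1 : F) [set~ 0].
  rewrite cardsC1 -/A; move: (_ \in _) (_ \in _) F_gt11 => b1 b2.
  by move: #|F| #|A| #|_| => n k l; lia.
have /dinjectivePn[a Aa [b /andP[/= ba Ab] eq_pat]] : ~~ dinjectiveb pat A.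
  apply/negP => /dinjectiveP/card_in_image card_pat; move: cardA.
  rewrite -card_pat ltnNge (leq_trans (max_card _)) //.
  by rewrite !card_prod !card_bool.
move: Aa Ab eq_pat; rewrite !inE => /and3P[a1 a1' a0] /and3P[b1 b1' b0] [E E1 E2].
exists (a, b); split=> /=; rewrite 1?eq_sym //.
- exact: residue_scaling_inj.
(* Adding the identity only shifts both slopes by 1. *)
- have h : injective (residue_scaling (a + 1) (b + 1)).
    by apply: residue_scaling_inj; rewrite ?addr_eq0.
  move=> x y xy; apply: h; move: xy; rewrite /residue_scaling.
  by rewrite -[X in _ + X = _]mul1r -[X in _ = _ + X]mul1r -!mulrDl; do 2!case: ifP => _.
- have h : injective (residue_scaling (a - 1) (b - 1)).
    by apply: residue_scaling_inj; rewrite ?subr_eq0.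
  move=> x y xy; apply: h; move: xy; rewrite /residue_scaling.
  by rewrite -[X in _ - X = _]mul1r -[X in _ = _ - X]mul1r -!mulrBl; do 2!case: ifP => _.
Qed.

End QuadraticCharacter.

(** * Toroidal queens solutions modulo n *)

Definition inj_mod (n : nat) (g : nat -> int) : Prop :=
  forall x y : nat, (x < n)%N -> (y < n)%N -> (n %| g x - g y)%Z -> x = y.

(* No nontrivial character of (Z/n)^2 is constant on the graph of [f]. *)
Definition affine_spanning (n : nat) (f : nat -> int) : Prop :=
  forall a b : int,
    (forall x, (x < n)%N -> (n %| a * x%:Z + b * (f x - f 0%N))%Z) ->
    (n %| a)%Z /\ (n %| b)%Z.

Record spanning_queens (n : nat) (f : nat -> int) : Prop := SpanningQueens {
  queens_inj : inj_mod n f;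
  queens_injD : inj_mod n (fun x => f x + x%:Z);
  queens_injB : inj_mod n (fun x => f x - x%:Z);
  queens_span : affine_spanning n f
}.

(** Cramer's rule: the relations at x and y form a linear system in a and b whose determinant is
    invertible mod n. *)
Lemma affine_spanning_det (n : nat) (f : nat -> int) (x y : nat) :
  (x < n)%N -> (y < n)%N ->
  coprimez n (x%:Z * (f y - f 0%N) - y%:Z * (f x - f 0%N)) -> affine_spanning n f.
Proof.
move=> xn yn cop a b ab; have abx := ab x xn; have aby := ab y yn.
split; rewrite -(Gauss_dvdzr _ cop).
  rewrite (_ : _ * a = (a * x%:Z + b * (f x - f 0%N)) * (f y - f 0%N)
                     - (a * y%:Z + b * (f y - f 0%N)) * (f x - f 0%N)); last by ring.
  by apply: rpredB; apply: dvdz_mulr.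
rewrite (_ : _ * b = (a * y%:Z + b * (f y - f 0%N)) * x%:Z
                   - (a * x%:Z + b * (f x - f 0%N)) * y%:Z); last by ring.
by apply: rpredB; apply: dvdz_mulr.
Qed.

(** * Lifting solutions from modulus m to modulus m q *)

Definition lift_map (m : nat) (c : int) (f : nat -> int) (x : nat) : int :=
  f (x %% m)%N + m%:Z * (c * (x %/ m)%N%:Z).

(** The values e = 0, 1, -1 treat f, f + id and f - id at once. Reduction mod m recovers the low
    digit x mod m; the high digits then enter with factor c + e, invertible mod q. *)
Lemma lift_map_inj (m q : nat) (e c : int) (f : nat -> int) : (0 < m)%N ->
  coprimez q (c + e) -> inj_mod m (fun x => f x + e * x%:Z) ->
  inj_mod (m * q) (fun x => lift_map m c f x + e * x%:Z).
Proof.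
move=> m_gt0 cop inj_f x y xmq ymq; rewrite /lift_map.
have xq : (x %/ m < q)%N by rewrite ltn_divLR // mulnC.
have yq : (y %/ m < q)%N by rewrite ltn_divLR // mulnC.
have xm := ltn_pmod x m_gt0; have ym := ltn_pmod y m_gt0.
have div_eqz z : z%:Z = (z %/ m)%N%:Z * m%:Z + (z %% m)%N%:Z.
  by rewrite -PoszM -PoszD -divn_eq.
rewrite (div_eqz x) (div_eqz y) {div_eqz}.
move: (divn_eq x m) (divn_eq y m).
move: (x %/ m)%N (x %% m)%N (y %/ m)%N (y %% m)%N xq xm yq ym.
move=> x1 x0 y1 y0 xq xm yq ym -> -> /dvdzP[k E].
have x0y0 : x0 = y0.
  apply: inj_f => //; apply/dvdzP.
  exists (k * q%:Z - (c + e) * (x1%:Z - y1%:Z)).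
  transitivity (k * (m * q)%N%:Z - (c + e) * (x1%:Z - y1%:Z) * m%:Z).
    by rewrite -E; ring.
  by rewrite PoszM; ring.
suff -> : x1 = y1 by rewrite x0y0.
have : (q %| x1%:Z - y1%:Z)%Z.
  rewrite -(Gauss_dvdzr _ cop); apply/dvdzP; exists k.
  apply: (@mulfI _ m%:Z); first by rewrite -lt0n.
  transitivity (k * (m * q)%N%:Z); last by rewrite PoszM; ring.
  by rewrite -E x0y0; ring.
by rewrite -eqz_mod_dvd !modz_nat !modn_small // => /eqP[].
Qed.

(** Spanning mod m gives a = a' m and b = b' m, so it remains to show that q divides a' and b'. The
    last hypothesis provides a point of the graph of f off the line of slope c through (0, f 0) mod
    q. *)
Lemma lift_map_spanning (m q : nat) (c : int) (f : nat -> int) :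
  (0 < m)%N -> prime q -> affine_spanning m f ->
  (~~ (q %| m)%N -> exists2 x, (x < m)%N & ~~ (q %| f x - f 0%N - c * x%:Z)%Z) ->
  affine_spanning (m * q) (lift_map m c f).
Proof.
move=> m_gt0 q_pr span_f notlin a b ab.
have q_gt1 := prime_gt1 q_pr.
have ab0 x : (x < m)%N -> ((m%:Z * q%:Z)%R %| a * x%:Z + b * (f x - f 0%N))%Z.
  move=> xm; have := ab x; rewrite /lift_map modn_small // divn_small // mod0n div0n.
  by rewrite !mulr0 !addr0 PoszM; apply; rewrite (leq_trans xm) // leq_pmulr // ltnW.
(* This is the relation at x = m, where only the high digit changes. *)
have ab1 : ((m%:Z * q%:Z)%R %| m%:Z * (a + b * c))%Z.
  have := ab m; rewrite /lift_map modnn divnn m_gt0 mod0n div0n !mulr0 addr0 mulr1.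
  rewrite [f 0%N + _]addrC addrK PoszM => h.
  rewrite mulrDr [m%:Z * a]mulrC [m%:Z * _]mulrCA; apply: h.
  by rewrite ltn_Pmulr.
have mq x : ((m%:Z * q%:Z)%R %| x)%Z -> (m %| x)%Z.
  exact: (dvdz_trans (dvdz_mulr _ (dvdzz m))).
have [/dvdzP[a' Ea] /dvdzP[b' Eb]] : (m %| a)%Z /\ (m %| b)%Z.
  by apply: span_f => x /ab0/mq.
have m0 : m%:Z != 0 by rewrite -lt0n.
have abq0 x : (x < m)%N -> (q %| a' * x%:Z + b' * (f x - f 0%N))%Z.
  move/ab0; rewrite Ea Eb.
  rewrite (_ : _ + _ = m%:Z * (a' * x%:Z + b' * (f x - f 0%N))); last by ring.
  by rewrite dvdz_mul2l.
suff [qa qb] : (q %| a')%Z /\ (q %| b')%Z.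
  by rewrite PoszM Ea Eb ![_ * m%:Z]mulrC !dvdz_mul2l // qa qb.
(* If m = k q, spanning mod m applies again, to k a' and k b'. Otherwise m is invertible mod q, so
   the relation at m gives q | a' + b' c. *)
have [/dvdnP[k Em]|q_ndvd] := boolP (q %| m)%N.
  have k0 : k%:Z != 0 by case: k Em m_gt0 => // ->.
  have : (m %| k%:Z * a')%Z /\ (m %| k%:Z * b')%Z.
    apply: span_f => x xm; rewrite Em PoszM -!mulrA -mulrDr dvdz_mul2l //.
    exact: abq0.
  by rewrite Em PoszM !dvdz_mul2l.
have [x xm nx] := notlin q_ndvd.
have q_ab : (q %| a' + b' * c)%Z.
  move: ab1; rewrite dvdz_mul2l // Ea Eb mulrAC -mulrDl Gauss_dvdzl //.
  by rewrite coprimezE /= prime_coprime.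
have qb : (q %| b')%Z.
  have : (q %| b' * (f x - f 0%N - c * x%:Z))%Z.
    rewrite (_ : _ * _ = (a' * x%:Z + b' * (f x - f 0%N)) - (a' + b' * c) * x%:Z).
      by apply: rpredB; [exact: abq0|exact: dvdz_mulr].
    ring.
  by rewrite Gauss_dvdzl // coprimezE prime_coprime.
by split=> //; rewrite -(rpredDr (a' : int) (dvdz_mulr c qb)).
Qed.

Lemma spanning_queens_lift (m q : nat) (f : nat -> int) :
  (1 < m)%N -> prime q -> (3 < q)%N -> spanning_queens m f ->
  exists g, spanning_queens (m * q) g.
Proof.
move=> m_gt1 q_pr q_gt3 [f0 fD fB f_span]; have m_gt0 := ltnW m_gt1.
(* For c = 2 or c = -2, the numbers c, c + 1 and c - 1 all have absolute value from 1 to 3. *)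
have cop (d : int) : (0 < `|d| <= 3)%N -> coprimez q d.
  move=> d_bd; rewrite coprimezE prime_coprime // gtnNdvd //; lia.
have queens c : (c == 2) || (c == -2) -> affine_spanning (m * q) (lift_map m c f) ->
    spanning_queens (m * q) (lift_map m c f).
  move=> c2 span; split=> //.
  - have := @lift_map_inj m q 0 c f m_gt0.
    move=> h x y xn yn E; apply: h => //.
    + by apply: cop; lia.
    + by move=> x' y'; rewrite !mul0r !addr0; exact: f0.
    + by rewrite !mul0r !addr0.
  - have := @lift_map_inj m q 1 c f m_gt0.
    move=> h x y xn yn E; apply: h => //.
    + by apply: cop; lia.
    + by move=> x' y'; rewrite !mul1r; exact: fD.
    + by rewrite !mul1r.
  - have := @lift_map_inj m q (-1) c f m_gt0.
    move=> h x y xn yn E; apply: h => //.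
    + by apply: cop; lia.
    + by move=> x' y'; rewrite !mulN1r; exact: fB.
    + by rewrite !mulN1r.
(* q cannot divide both f 1 - f 0 - 2 and f 1 - f 0 + 2. *)
have [q2|q2] := boolP (q %| f 1%N - f 0%N - 2)%Z.
  exists (lift_map m (-2) f); apply: queens => //; apply: lift_map_spanning => // _.
  exists 1%N => //; rewrite mulr1; apply/negP => /(rpredB q2) h.
  have : (q %| 2 ^ 2)%N.
    move: h; rewrite (_ : _ - _ = -(4)) ?rpredN; last by ring.
    by rewrite dvdzE.
  by rewrite Euclid_dvdX // => /andP[/dvdn_leq]; lia.
by exists (lift_map m 2 f); apply: queens => //;
  apply: lift_map_spanning => // _; exists 1%N.
Qed.

(** * Explicit solutions, verified by computation *)

Lemma inj_mod_uniq (n : nat) (g : nat -> int) :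
  uniq [seq (g x %% n)%Z | x <- iota 0 n] -> inj_mod n g.
Proof.
set t := map _ _ => t_uniq x y xn yn; rewrite -eqz_mod_dvd => xy.
have nth_t z : (z < n)%N -> nth 0 t z = (g z %% n)%Z.
  by move=> zn; rewrite (nth_map 0%N) ?size_iota // nth_iota.
have t_size : size t = n by rewrite size_map size_iota.
by apply/eqP; rewrite -(nth_uniq 0 _ _ t_uniq) ?t_size // !nth_t.
Qed.

Definition queens_table (s : seq nat) (x : nat) : int := (nth 0%N s x)%:Z.

(** The last conjunct is the determinant of [affine_spanning_det] at the points 1 and [y]. *)
Definition table_check (n : nat) (f : nat -> int) (y : nat) : bool :=
  [&& uniq [seq (f x %% n)%Z | x <- iota 0 n],
      uniq [seq ((f x + x%:Z) %% n)%Z | x <- iota 0 n],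
      uniq [seq ((f x - x%:Z) %% n)%Z | x <- iota 0 n],
      (1 < n)%N, (y < n)%N &
      coprimez n (f y - f 0%N - y%:Z * (f 1%N - f 0%N))].

Lemma table_checkP (n : nat) (f : nat -> int) (y : nat) :
  table_check n f y -> spanning_queens n f.
Proof.
case/and5P=> /inj_mod_uniq f0 /inj_mod_uniq fD /inj_mod_uniq fB n_gt1.
case/andP=> yn cop; split=> //; apply: (@affine_spanning_det _ _ 1 y) => //.
by rewrite mul1r.
Qed.

(* The tables come from a backtracking search for solutions with f(h x) = h f(x)
   for all h in a nontrivial subgroup of (Z/v)^*. *)
Lemma spanning_queens25 : exists f, spanning_queens 25 f.
Proof.
exists (queens_table [::
    0; 5; 22; 12; 16; 6; 23; 10; 14; 7; 17; 21; 1; 24; 4; 8; 18; 11; 15;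
    2; 19; 9; 13; 3; 20]%N).
by apply: (@table_checkP _ _ 2); vm_compute.
Qed.

Lemma spanning_queens35 : exists f, spanning_queens 35 f.
Proof.
exists (queens_table [::
    0; 23; 1; 6; 22; 25; 17; 21; 4; 32; 15; 8; 24; 26; 7; 5; 18; 34; 9;
    13; 30; 28; 11; 29; 33; 20; 27; 19; 14; 2; 10; 12; 16; 31; 3]%N).
by apply: (@table_checkP _ _ 6); vm_compute.
Qed.

Lemma spanning_queens49 : exists f, spanning_queens 49 f.
Proof.
exists (queens_table [::
    0; 20; 48; 35; 39; 42; 40; 5; 28; 13; 34; 19; 22; 18; 3; 38; 25; 23;
    17; 37; 4; 8; 43; 16; 2; 47; 33; 6; 41; 45; 12; 32; 26; 24; 11; 46;
    31; 27; 30; 15; 36; 21; 44; 9; 7; 10; 14; 1; 29]%N).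
by apply: (@table_checkP _ _ 2); vm_compute.
Qed.

Lemma spanning_queens55 : exists f, spanning_queens 55 f.
Proof.
exists (queens_table [::
    0; 8; 16; 51; 32; 30; 47; 1; 9; 17; 5; 33; 39; 49; 2; 35; 18; 26; 34;
    48; 10; 27; 11; 6; 23; 40; 43; 19; 4; 53; 15; 28; 36; 44; 52; 45; 13;
    24; 41; 3; 20; 37; 54; 14; 22; 50; 12; 29; 46; 7; 25; 42; 31; 21; 38]%N).
by apply: (@table_checkP _ _ 3); vm_compute.
Qed.

Lemma spanning_queens77 : exists f, spanning_queens 77 f.
Proof.
exists (queens_table [::
    0; 51; 1; 40; 50; 41; 75; 49; 4; 74; 48; 22; 6; 47; 21; 72; 46; 20; 9;
    45; 10; 70; 44; 18; 69; 43; 13; 52; 42; 53; 15; 54; 16; 66; 17; 14;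
    65; 39; 19; 58; 38; 12; 63; 60; 11; 61; 23; 62; 24; 35; 25; 64; 34; 8;
    59; 33; 7; 67; 32; 68; 57; 31; 5; 56; 30; 71; 55; 29; 3; 73; 28; 2;
    36; 27; 37; 76; 26]%N).
by apply: (@table_checkP _ _ 2); vm_compute.
Qed.

Lemma spanning_queens121 : exists f, spanning_queens 121 f.
Proof.
exists (queens_table [::
    0; 88; 46; 22; 78; 40; 17; 83; 80; 66; 50; 47; 113; 72; 112; 120; 107;
    10; 51; 73; 109; 7; 61; 116; 119; 93; 18; 77; 19; 35; 29; 34; 90; 20;
    16; 45; 97; 64; 53; 95; 11; 96; 94; 67; 56; 118; 84; 117; 79; 6; 52;
    30; 15; 58; 32; 59; 39; 98; 100; 13; 85; 36; 108; 21; 23; 82; 62; 89;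
    63; 106; 91; 69; 115; 42; 4; 37; 3; 65; 54; 27; 25; 110; 26; 68; 57;
    24; 76; 105; 101; 31; 87; 92; 86; 102; 44; 103; 28; 2; 5; 60; 114; 12;
    48; 70; 111; 14; 1; 9; 49; 8; 74; 71; 55; 41; 38; 104; 81; 43; 99; 75;
    33]%N).
by apply: (@table_checkP _ _ 2); vm_compute.
Qed.

(** * Existence of solutions: primes, then all admissible orders *)

Lemma spanning_queens_prime (p : nat) : prime p -> (11 < p)%N ->
  exists f, spanning_queens p f.
Proof.
move=> p_pr p_gt11; have pcharFp := pchar_Fp p_pr.
have cardFp : #|'F_p| = p by exact: card_Fp.
have F_odd : odd #|'F_p| by rewrite cardFp; case: (even_prime p_pr) p_gt11 => [->|].
have F_gt11 : (11 < #|'F_p|)%N by rewrite cardFp.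
have [[a b] [/= ab f0 fD fB]] := exists_residue_scaling F_odd F_gt11.
have [|y y_neq0 y_nonres] := quad_char_nonresidue F_odd; first by rewrite cardFp; lia.
have FpK (x : 'F_p) : x%:R = x by rewrite natr_Zp.
have Fp_lt (x : 'F_p) : (x < p)%N by rewrite -{2}(Fp_cast p_pr) ltn_ord.
pose f (x : nat) : int := (nat_of_ord (residue_scaling a b (x%:R : 'F_p)))%:Z.
have fE x : (f x)%:~R = residue_scaling a b (x%:R : 'F_p) by rewrite /f -pmulrn FpK.
have natr_inj x y' : (x < p)%N -> (y' < p)%N -> x%:R = y'%:R :> 'F_p -> x = y'.
  by move=> xp yp /(congr1 val); rewrite /= !val_Fp_nat // !modn_small.
exists f; split.
- move=> x z xp zp; rewrite (dvdz_pcharf pcharFp) rmorphB /= !fE subr_eq0.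
  by move=> /eqP/f0/natr_inj; apply.
- move=> x z xp zp; rewrite (dvdz_pcharf pcharFp) rmorphB !rmorphD /= !fE subr_eq0.
  by move=> /eqP/fD/natr_inj; apply.
- move=> x z xp zp; rewrite (dvdz_pcharf pcharFp) !rmorphB /= !fE subr_eq0.
  by move=> /eqP/fB/natr_inj; apply.
(* As 1 is a square and y is not, the graph contains (0, 0), (1, a) and (y, b y), with determinant y
   (b - a). *)
apply: (@affine_spanning_det _ _ 1%N y) => //; first exact: prime_gt1.
rewrite coprimezE prime_coprime // -dvdzE (dvdz_pcharf pcharFp).
rewrite rmorphB !rmorphM !rmorphB /= !fE !FpK /residue_scaling mulr0 !subr0.
rewrite /quad_char expr1n eqxx -/(quad_char y) (negbTE y_nonres).
by rewrite -!pmulrn FpK mul1r mulr1 mulrC -mulrBr mulf_neq0 // subr_eq0 eq_sym.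
Qed.

(** Strong induction, splitting off the least prime factor q of a composite v = m q. If m is 5, 7 or
    11, then q <= m lies in the same list, which leaves the six tabulated orders. *)
Lemma spanning_queens_exist (v : nat) : (0 < v)%N -> coprime v 6 ->
  v \notin [:: 5; 7; 11]%N -> exists f, spanning_queens v f.
Proof.
elim/ltn_ind: v => v IHv v_gt0 v6 v_excl.
move: v_gt0; rewrite leq_eqVlt => /predU1P[<-|v_gt1].
  by exists (fun=> 0); split=> [x y|x y|x y|a b _]; rewrite ?dvd1z //;
    case: x y => [|x] [|y].
have prime_ge5 q : prime q -> (q %| v)%N -> (4 < q)%N.
  move=> q_pr /coprime_dvdl/(_ v6); rewrite (@coprimeMr _ 2 3) !(coprime_sym q).
  by rewrite !prime_coprime //; case: q q_pr => [|[|[|[|[]]]]].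
have [v_pr|v_npr] := boolP (prime v).
  apply: spanning_queens_prime => //; rewrite ltnNge; apply: contra v_excl => v_le.
  have := prime_ge5 _ v_pr (dvdnn v); move: v_le v_pr {IHv v_gt1 v6 prime_ge5}.
  by do 12 case: v => [|v] //.
have q_pr := pdiv_prime v_gt1; have /dvdnP[m Ev] := pdiv_dvd v.
set q := pdiv v in q_pr Ev.
have q_ge5 : (4 < q)%N by apply: prime_ge5 => //; exact: pdiv_dvd.
have m_gt1 : (1 < m)%N.
  move: Ev v_gt1; case: m => [->//|[|//]]; rewrite mul1n => E _.
  by rewrite E q_pr in v_npr.
have m_lt : (m < v)%N by rewrite Ev ltn_Pmulr ?prime_gt1 // ltnW.
have m6 : coprime m 6 by apply: coprime_dvdl v6; rewrite Ev dvdn_mulr.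
have [m_excl|m_ok] := boolP (m \in [:: 5; 7; 11]%N); last first.
  have [f Hf] := IHv m m_lt (ltnW m_gt1) m6 m_ok.
  by rewrite Ev; apply: spanning_queens_lift Hf => //; exact: ltnW.
have q_le : (q <= m)%N by apply: pdiv_min_dvd => //; rewrite Ev dvdn_mulr.
have q_cases : q \in [:: 5; 7; 11]%N.
  have {}q_le : (q <= 11)%N by move: m_excl q_le; rewrite !inE; lia.
  by move: q_pr q_ge5 q_le; clearbody q; clear; do 12 case: q => [|q] //.
move: m_excl q_cases q_le; rewrite Ev !inE; clearbody q.
case/or3P=> /eqP-> /or3P[]/eqP-> // _.
- exact: spanning_queens25.
- exact: spanning_queens35.
- exact: spanning_queens49.
- exact: spanning_queens55.
- exact: spanning_queens77.
- exact: spanning_queens121.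
Qed.

(** * Roots of unity and character sums *)

Lemma prim_root_exists (C : numClosedFieldType) (n : nat) : (0 < n)%N ->
  exists w : C, n.-primitive_root w.
Proof.
move=> n_gt0; pose p : {poly C} := 'X^n - 1.
have [r Dp] := closed_field_poly_normal p.
rewrite (monicP _) ?monicXnsubC // scale1r in Dp.
have r_unity : all n.-unity_root r.
  by apply/allP=> z; rewrite -root_prod_XsubC -Dp.
have r_size : (n < (size r).+1)%N.
  by rewrite -(size_prod_XsubC r id) -Dp size_XnsubC.
have [|z] := hasP (has_prim_root n_gt0 r_unity _ r_size); last by exists z.
(* In characteristic 0, X^n - 1 is separable, so its n roots are distinct. *)
by rewrite -separable_prod_XsubC -Dp separable_Xn_sub_1 // pnatr_eq0 -lt0n.
Qed.

Lemma prim_root_conj (C : numClosedFieldType) (n : nat) (w : C) :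
  n.-primitive_root w -> w^* = w^-1.
Proof.
move=> w_prim; rewrite invC_norm; have n_gt0 := prim_order_gt0 w_prim.
suff /eqP -> : `|w| == 1 by rewrite expr1n invr1 mul1r.
by rewrite -(pexpr_eq1 n_gt0) // -normrX prim_expr_order // normr1.
Qed.

Lemma prim_root_neq0 (F : fieldType) (n : nat) (w : F) :
  n.-primitive_root w -> w != 0.
Proof.
move=> w_prim; apply: contra_eq_neq (prim_expr_order w_prim) => ->.
by rewrite expr0n -leqn0 leqNgt (prim_order_gt0 w_prim) eq_sym oner_neq0.
Qed.

Lemma prim_root_exprz_eq1 (F : fieldType) (n : nat) (w : F) (m : int) :
  n.-primitive_root w -> (w ^ m == 1) = (n %| m)%Z.
Proof.
move=> w_prim; case: m => m; first by rewrite dvdzE (prim_order_dvd w_prim).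
by rewrite NegzE -invr_expz invr_eq1 rpredN dvdzE (prim_order_dvd w_prim).
Qed.

Lemma prim_root_exprz_eq (F : fieldType) (n : nat) (w : F) (m1 m2 : int) :
  n.-primitive_root w -> (w ^ m1 == w ^ m2) = (n %| m1 - m2)%Z.
Proof.
move=> w_prim; have w_neq0 := prim_root_neq0 w_prim.
rewrite -(prim_root_exprz_eq1 _ w_prim) expfzDr // -invr_expz.
have w2_neq0 : w ^ m2 != 0 by rewrite expfz_neq0.
by rewrite (can2_eq (divfK w2_neq0) (mulfK w2_neq0)) mul1r.
Qed.

Section Residues.

Variables (n : nat) (n_gt0 : (0 < n)%N).

Lemma modz_ord_proof (m : int) : (`|(m %% n)%Z| < n)%N.
Proof. by rewrite -ltz_nat gez0_abs ?modz_ge0 ?ltz_pmod // -lt0n. Qed.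

Definition modz_ord (m : int) : 'I_n := Ordinal (modz_ord_proof m).

Lemma modz_ordE (m : int) : (modz_ord m)%:Z = (m %% n)%Z.
Proof. by rewrite /= gez0_abs ?modz_ge0 // -lt0n. Qed.

Lemma eq_modz_ord (i : 'I_n) (m : int) : (i == modz_ord m) = (n %| i%:Z - m)%Z.
Proof.
rewrite -eqz_mod_dvd -val_eqE -[LHS]/(i%:Z == (modz_ord m)%:Z) modz_ordE.
by rewrite modz_nat modn_small.
Qed.

End Residues.

Lemma eq_ord_dvdz (n : nat) (i j : 'I_n) : (i == j) = (n %| i%:Z - j%:Z)%Z.
Proof. by rewrite -eqz_mod_dvd !modz_nat !modn_small. Qed.

(** Mod n, g permutes the residues, so the sum is the full geometric sum of w^d. Multiplying it by
    w^d - 1, which is nonzero, gives w^(d n) - 1 = 0. *)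
Lemma sum_prim_root_inj_mod (F : fieldType) (n : nat) (w : F) (g : nat -> int)
    (d : int) : n.-primitive_root w -> inj_mod n g -> ~~ (n %| d)%Z ->
  \sum_(k < n) w ^ (d * g k) = 0.
Proof.
move=> w_prim g_inj nd; have n_gt0 := prim_order_gt0 w_prim.
pose h (k : 'I_n) := modz_ord n_gt0 (g k).
have h_inj : injective h.
  move=> k l /eqP; rewrite eq_modz_ord modz_ordE -eqz_mod_dvd modz_mod eqz_mod_dvd.
  by move/g_inj => kl; apply/val_inj/kl.
transitivity (\sum_(k < n) (w ^ d) ^+ h k).
  apply: eq_bigr => k _; apply/eqP; rewrite exprnP exprz_exp.
  rewrite (prim_root_exprz_eq _ _ w_prim) -mulrBr; apply: dvdz_mull.
  by rewrite modz_ordE -eqz_mod_dvd modz_mod.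
rewrite -(reindex_inj h_inj (P := xpredT) (F := fun k : 'I_n => (w ^ d) ^+ k)).
have wd_neq1 : w ^ d - 1 != 0 by rewrite subr_eq0 (prim_root_exprz_eq1 _ w_prim).
apply: (mulfI wd_neq1); rewrite -subrX1 mulr0; apply/eqP; rewrite subr_eq0.
by rewrite exprnP exprz_exp (prim_root_exprz_eq1 _ w_prim) dvdz_mull.
Qed.

(** * Inner products and orthonormal bases *)

Lemma innerE (R : realType) (n : nat) (u v : 'cV[R[i]]_n) :
  inner u v = \sum_k u k 0 * (v k 0)^*.
Proof. by rewrite /inner dotmxE mxE; apply: eq_bigr => k _; rewrite !mxE. Qed.

Lemma inner_suml (R : realType) (n : nat) (I : finType) (c : I -> R[i])
    (u : I -> 'cV[R[i]]_n) (v : 'cV[R[i]]_n) :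
  inner (\sum_x c x *: u x) v = \sum_x c x * inner (u x) v.
Proof.
rewrite innerE.
under eq_bigr => k _ do rewrite summxE mulr_suml.
rewrite exchange_big /=; apply: eq_bigr => x _; rewrite innerE mulr_sumr.
by apply: eq_bigr => k _; rewrite !mxE mulrA.
Qed.

(** Pairing a vanishing combination with each vector kills its coefficient, so the family is free,
    and n free vectors span by dimension. *)
Lemma orthonormal_basis_on_card (R : realType) (n : nat) (I : finType)
    (A : {set I}) (F : I -> 'cV[R[i]]_n) :
  #|A| = n -> {in A &, forall x y, inner (F x) (F y) = (x == y)%:R} ->
  orthonormal_basis_on A F.
Proof.
move=> cardA F_orth; split=> //.
have size_F : size [seq F x | x in A] = n by rewrite size_map -cardE.
rewrite basisEfree subvf size_F dimvf /dim /= muln1 leqnn andbT.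
apply: (@introT _ _ (@freeP _ _ _ (map_tuple F (enum_tuple A)))) => c sum0 i.
have nth_F (k : 'I_#|A|) : (map_tuple F (enum_tuple A))`_k = F (enum_val k).
  by rewrite (nth_map (enum_default k)) -?enum_val_nth // -cardE.
have := congr1 (fun u => inner u (F (enum_val i))) sum0.
under eq_bigr => k _ do rewrite nth_F.
rewrite inner_suml (bigD1 i) //= F_orth ?enum_valP // eqxx mulr1.
rewrite big1 => [|k ki]; last first.
  by rewrite F_orth ?enum_valP // (inj_eq enum_val_inj) (negbTE ki) mulr0.
rewrite addr0 => ->; rewrite innerE big1 // => k _.
by rewrite mxE mul0r.
Qed.

(** * The quantum Latin square built from w and f *)

Section FourierSquare.

Variables (R : realType) (n : nat) (w : R[i]) (f : nat -> int).
Hypotheses (w_prim : n.-primitive_root w) (f_queens : spanning_queens n f).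

Definition fourier_square (i j : 'I_n) : 'cV[R[i]]_n :=
  \col_k ((sqrtC n%:R)^-1 * w ^ (j%:Z * k%:Z + i%:Z * f k)).

Let n_gt0 : (0 < n)%N. Proof. exact: prim_order_gt0 w_prim. Qed.

Lemma inner_fourier_square (i j i' j' : 'I_n) :
  inner (fourier_square i j) (fourier_square i' j') =
  n%:R^-1 * \sum_(k < n) w ^ ((j%:Z - j'%:Z) * k%:Z + (i%:Z - i'%:Z) * f k).
Proof.
rewrite innerE mulr_sumr; apply: eq_bigr => k _; rewrite !mxE.
have w_neq0 := prim_root_neq0 w_prim.
rewrite rmorphM fmorphV /= fmorphXz /= (prim_root_conj w_prim) exprz_inv.
rewrite conj_Creal ?ger0_real ?sqrtC_ge0 ?ler0n // mulrACA -invfM -expr2 sqrtCK.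
by rewrite -expfzDr //; congr (_ * _ ^ _); ring.
Qed.

Lemma inner_fourier_square_eq (i j : 'I_n) :
  inner (fourier_square i j) (fourier_square i j) = 1.
Proof.
rewrite inner_fourier_square !subrr.
rewrite (eq_bigr (fun=> 1)) => [|k _]; last by rewrite !mul0r addr0 expr0z.
by rewrite sumr_const card_ord mulVf // pnatr_eq0 -lt0n.
Qed.

Lemma inner_fourier_square_row (i j j' : 'I_n) : j != j' ->
  inner (fourier_square i j) (fourier_square i j') = 0.
Proof.
move=> jj'; rewrite inner_fourier_square.
rewrite (eq_bigr (fun k : 'I_n => w ^ ((j%:Z - j'%:Z) * k%:Z))); last first.
  by move=> k _; rewrite subrr mul0r addr0.
rewrite (sum_prim_root_inj_mod (g := Posz) w_prim) ?mulr0 -?eq_ord_dvdz //.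
move=> x y xn yn; rewrite -[x]/(val (Ordinal xn)) -[y]/(val (Ordinal yn)).
by rewrite -eq_ord_dvdz => /eqP->.
Qed.

(* [e = 0, 1, -1] covers the columns and the two families of diagonals. *)
Lemma inner_fourier_square_line (e : int) (i j i' j' : 'I_n) :
  inj_mod n (fun x => f x + e * x%:Z) -> i != i' ->
  (n %| (j%:Z - j'%:Z) - e * (i%:Z - i'%:Z))%Z ->
  inner (fourier_square i j) (fourier_square i' j') = 0.
Proof.
move=> fe_inj ii' line; rewrite inner_fourier_square.
rewrite (eq_bigr (fun k : 'I_n => w ^ ((i%:Z - i'%:Z) * (f k + e * k%:Z)))).
  by rewrite (sum_prim_root_inj_mod w_prim fe_inj) ?mulr0 -?eq_ord_dvdz.
move=> k _; apply/eqP; rewrite (prim_root_exprz_eq _ _ w_prim).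
rewrite (_ : _ - _ = (j%:Z - j'%:Z - e * (i%:Z - i'%:Z)) * k%:Z); last by ring.
exact: dvdz_mulr.
Qed.

(** T is the graph of i |-> e i + s mod n, hence has one cell per row; invertibility of e separates
    the columns. *)
Lemma fourier_square_transversal (e s : int) (T : {set 'I_n * 'I_n}) :
  coprimez n e -> inj_mod n (fun x => f x + e * x%:Z) ->
  (forall c, (c \in T) = (n %| c.2%:Z - (e * c.1%:Z + s))%Z) ->
  is_QLS_transversal fourier_square T.
Proof.
move=> cop fe_inj in_T.
pose h (i : 'I_n) := modz_ord n_gt0 (e * i%:Z + s).
have TE : T = [set (i, h i) | i : 'I_n].
  apply/setP=> -[i j]; rewrite in_T -(eq_modz_ord n_gt0) /=.
  apply/eqP/imsetP => [->|[i' _ [-> ->]]] //; by exists i.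
have row_inj : {in T &, forall c d, c.1 = d.1 -> c = d}.
  by move=> c d; rewrite TE => /imsetP[i _ ->] /imsetP[k _ ->] /= ->.
have line c d : c \in T -> d \in T ->
    (n %| c.2%:Z - d.2%:Z - e * (c.1%:Z - d.1%:Z))%Z.
  rewrite !in_T => cT dT; have := rpredB cT dT.
  by rewrite (_ : _ - _ - (_ - _) = c.2%:Z - d.2%:Z - e * (c.1%:Z - d.1%:Z)) //; ring.
have cardT : #|T| = n by rewrite TE card_imset ?card_ord // => i k [].
split=> //.
- move=> c d cT dT cd; apply: row_inj => //; apply/eqP; rewrite eq_ord_dvdz.
  have := line c d cT dT; rewrite cd subrr sub0r rpredN.
  by rewrite Gauss_dvdzr.
- apply: orthonormal_basis_on_card => // c d cT dT.
  have [->|cd] := eqVneq c d; first exact: inner_fourier_square_eq.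
  apply: (inner_fourier_square_line fe_inj _ (line c d cT dT)).
  by apply: contra cd => /eqP/row_inj->.
Qed.

Lemma fourier_square_QLS : is_QLS fourier_square.
Proof.
split=> [i j|i|j]; first exact: inner_fourier_square_eq.
- apply: orthonormal_basis_on_card => [|j j' _ _]; first by rewrite cardsT card_ord.
  have [->|jj'] := eqVneq j j'; first exact: inner_fourier_square_eq.
  exact: inner_fourier_square_row.
- apply: orthonormal_basis_on_card => [|i i' _ _]; first by rewrite cardsT card_ord.
  have [->|ii'] := eqVneq i i'; first exact: inner_fourier_square_eq.
  apply: (@inner_fourier_square_line 0) => //; last by rewrite subrr mul0r subrr dvdz0.
  by move=> x y xn yn; rewrite !mul0r !addr0; exact: queens_inj.
Qed.

Lemma fourier_square_distinct (i j k l : 'I_n) :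
  phase_equiv (fourier_square i j) (fourier_square k l) -> (i, j) = (k, l).
Proof.
case=> theta; set u := (X in _ = X *: _) => /colP eq_ij.
have w_neq0 := prim_root_neq0 w_prim.
pose E (x : 'I_n) := (j%:Z - l%:Z) * x%:Z + (i%:Z - k%:Z) * f x.
(* [w ^ E x] is the ratio of the x-th coordinates, hence equals the common phase [u]. Comparing it
   with x = 0 yields the relation tested by [affine_spanning]. *)
have wE x : w ^ E x = u.
  have := eq_ij x; rewrite !mxE mulrCA => /mulfI.
  rewrite invr_eq0 sqrtC_eq0 pnatr_eq0 -lt0n => /(_ n_gt0) w_eq.
  rewrite (_ : E x = (j%:Z * x%:Z + i%:Z * f x) - (l%:Z * x%:Z + k%:Z * f x)).
    by rewrite expfzDr // w_eq -invr_expz mulfK // expfz_neq0.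
  by rewrite /E; ring.
have [|jl ik] := queens_span f_queens (a := j%:Z - l%:Z) (b := i%:Z - k%:Z).
  move=> x xn; have /eqP := etrans (wE (Ordinal xn)) (esym (wE (Ordinal n_gt0))).
  rewrite (prim_root_exprz_eq _ _ w_prim) /E /=.
  by congr (is_true (_ %| _)%Z); ring.
by move: jl ik; rewrite -!eq_ord_dvdz => /eqP-> /eqP->.
Qed.

Lemma fourier_square_MCPQLS : is_MCPQLS fourier_square.
Proof.
split; last by move=> i j k l ijkl /fourier_square_distinct.
have coprime1 : coprimez n 1 by rewrite coprimezE coprimen1.
have coprimeN1 : coprimez n (-1) by rewrite coprimezE coprimen1.
split=> [|s|s]; first exact: fourier_square_QLS.
(* Solved for the column, i - j = s reads j = i - s, and i + j = s reads j = -i + s. *)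
- apply: (@fourier_square_transversal 1 (- s%:Z)) => // [x y xn yn|c].
    by rewrite !mul1r; exact: queens_injD.
  rewrite inE eqz_mod_dvd -rpredN; congr (_ %| _)%Z; ring.
- apply: (@fourier_square_transversal (-1) s%:Z) => // [x y xn yn|c].
    by rewrite !mulN1r; exact: queens_injB.
  rewrite inE eqz_mod_dvd; congr (_ %| _)%Z; ring.
Qed.

End FourierSquare.

Theorem theorem2p15 (R : realType) (v : nat) (v_gt0 : (0 < v)%N)
  (v_coprime6 : gcdn v 6 = 1%N) (v_excl : v \notin [:: 5; 7; 11]%N) :
  exists L : 'I_v -> 'I_v -> 'cV[R[i]]_v, is_MCPQLS L.
Proof.
have [f f_queens] := spanning_queens_exist v_gt0 (introT eqP v_coprime6) v_excl.
have [w w_prim] := prim_root_exists R[i] v_gt0.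
by exists (fourier_square w f); exact: fourier_square_MCPQLS.
Qed.
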